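(* Let $\mathcal{P}$ be a pseudo order ideal in $P$ with $\mu$ elements, and let its pseudo border $b\mathcal{P}$ have $\alpha$ elements. Let $I\subset P$ be an ideal such that $\mathcal{P}$ is a basis modulo $I$, and let $\varphi:P\to P$ be a linear change of coordinates. Write $\varphi^{-1}(\mathcal{P})\equiv\mathcal{P}\cdot M_\varphi\pmod I$ with a matrix $M_\varphi\in\mathrm{Mat}_\mu(K)$, and write $\varphi^{-1}(b\mathcal{P})\equiv\mathcal{P}\cdot N_\varphi\pmod I$ with a matrix $N_\varphi\in\mathrm{Mat}_{\mu,\alpha}(K)$. Then the following conditions are equivalent. (a) The set $\mathcal{P}$ is a basis modulo $\varphi(I)$. (b) The matrix $M_\varphi$ is invertible. In this case the ideal $\varphi(I)$ is represented by $C_{\varphi(I)}=M_\varphi^{-1}\cdot N_\varphi$ in $\mathbb{B}_{\mathcal{P}}$.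
   Context: $K$ is a field, $P=K[x_1,\dots,x_n]$, and $\mathbb{T}^n$ is the monoid of terms (power products). A linear change of coordinates is a $K$-algebra automorphism $\varphi:P\to P$ mapping each indeterminate to a (not necessarily homogeneous) linear polynomial. An order ideal is a finite set $\mathcal{O}\subset\mathbb{T}^n$ closed under forming divisors. Its border is $\partial\mathcal{O}=(x_1\mathcal{O}\cup\cdots\cup x_n\mathcal{O})\setminus\mathcal{O}$. Its corner set $c\mathcal{O}$ is the set of minimal monomial generators of the monomial ideal $\mathbb{T}^n\setminus\mathcal{O}$. For a term ordering $\sigma$, $\mathcal{O}$ is a $\sigma$-cornercut if $b>_\sigma t$ for all $b\in c\mathcal{O}$ and $t\in\mathcal{O}$. A set of polynomials $\mathcal{P}$ is a pseudo order ideal with pseudo border $b\mathcal{P}$ if one of the following holds for some linear change of coordinates $\phi$: (i) $\mathcal{P}=\phi(\mathcal{O})$ for an order ideal $\mathcal{O}$ and $b\mathcal{P}=\phi(\partial\mathcal{O})$; or (ii) $\mathcal{P}=\phi(\mathcal{O})$ for a $\sigma$-cornercut $\mathcal{O}$ (for some term ordering $\sigma$) and $b\mathcal{P}=\phi(c\mathcal{O})$. $\mathcal{P}$ is a basis modulo an ideal $I$ if the residue classes of its elements form a $K$-basis of $P/I$. In this case the matrix representing $I$ in $\mathbb{B}_{\mathcal{P}}$ is the unique matrix $C_I\in\mathrm{Mat}_{\mu,\alpha}(K)$ with $b\mathcal{P}\equiv\mathcal{P}\cdot C_I\pmod I$, where the sets $\mathcal{P}$, $b\mathcal{P}$ are treated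 as row vectors and $\varphi^{-1}$ is applied entrywise. (Here $\mathbb{B}_{\mathcal{P}}$ is the affine scheme whose $K$-rational points correspond to the ideals modulo which $\mathcal{P}$ is a basis, via $I\mapsto C_I$.) *)

(* Defs.v *)
From HB Require Import structures.
From mathcomp Require Import all_boot all_order all_algebra.
From mathcomp Require Export mpoly.
From mathcomp Require Export boolp classical_sets functions cardinality.

Set Implicit Arguments.
Unset Strict Implicit.
Unset Printing Implicit Defensive.

Import Order.TTheory GRing.Theory.
Local Open Scope classical_set_scope.
Local Open Scope ring_scope.

(* The term x^m is represented by its exponent vector m : 'X_{1..n}, so that  *)
(* the product of terms is (m1 + m2)%MM, divisibility is (m1 <= m2)%MM, the   *)
(* term 1 is 0%MM, and the associated polynomial is 'X_[m].                   *)

Section Terms.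
Variable n : nat.
Implicit Type O : set 'X_{1..n}.

Definition order_ideal O : Prop :=
  finite_set O /\ forall t t', (t' <= t)%MM -> O t -> O t'.

Definition border O : set 'X_{1..n} :=
  (\bigcup_(i : 'I_n) [set (U_(i) + t)%MM | t in O]) `\` O.

(* The minimal monomial generators of the monomial ideal of terms outside O   *)
(* are the elements of ~` O that are minimal for divisibility.                *)
Definition corners O : set 'X_{1..n} :=
  [set b | ~ O b /\ forall t, ~ O t -> (t <= b)%MM -> t = b].

(* [le s t] means s <=_sigma t.                                               *)
Record term_ordering (le : rel 'X_{1..n}) : Prop := TermOrdering {
  term_ordering_refl : reflexive le;
  term_ordering_anti : antisymmetric le;
  term_ordering_trans : transitive le;
  term_ordering_total : total le;
  term_ordering_ge1 : forall t, le 0%MM t;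
  term_ordering_mul : forall u s t, le s t -> le (s + u)%MM (t + u)%MM }.

Definition cornercut (le : rel 'X_{1..n}) O : Prop :=
  order_ideal O /\ forall b t, corners O b -> O t -> le t b && (t != b).

End Terms.

Section PseudoOrderIdeals.
Variables (K : fieldType) (n : nat).
Local Notation P := {mpoly K[n]}.

(* [msize p = 2] says that p has total degree exactly 1.                      *)
Record linear_change := LinearChange {
  lc_fun :> {lrmorphism P -> P};
  lc_inv : P -> P;
  lc_funK : cancel lc_fun lc_inv;
  lc_invK : cancel lc_inv lc_fun;
  lc_linear : forall i : 'I_n, msize (lc_fun 'X_i) = 2%N }.

Definition change_terms (phi : linear_change) (S : set 'X_{1..n}) : set P :=
  [set phi 'X_[t] | t in S].

Definition pseudo_order_ideal (calP bP : set P) : Prop :=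
  exists (phi : linear_change) (O : set 'X_{1..n}),
    calP = change_terms phi O /\
    (order_ideal O /\ bP = change_terms phi (border O) \/
     (exists2 le, term_ordering le & cornercut le O) /\
       bP = change_terms phi (corners O)).

(* The improper ideal is allowed, unlike in [idealr_closed].                  *)
Record is_ideal (I : set P) : Prop := IsIdeal {
  ideal0 : I 0;
  idealD : forall p q, I p -> I q -> I (p + q);
  idealM : forall p q, I q -> I (p * q) }.

(* The row vector v lists the elements of the set S, each exactly once.       *)
Definition enumerates m (v : 'rV[P]_m) (S : set P) : Prop :=
  injective (v ord0) /\ range (v ord0) = S.

Definition congr_mod (I : set P) m p (A B : 'M[P]_(m, p)) : Prop :=
  forall i j, I (A i j - B i j).

Definition mxconst m p (C : 'M[K]_(m, p)) : 'M[P]_(m, p) :=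
  map_mx (@mpolyC n K) C.

(* The residue classes of the entries of v generate the K-vector space P / I  *)
(* and are linearly independent.                                              *)
Definition basis_mod (I : set P) mu (v : 'rV[P]_mu) : Prop :=
  (forall p, exists c : 'I_mu -> K, I (p - \sum_i c i *: v ord0 i)) /\
  (forall c : 'I_mu -> K, I (\sum_i c i *: v ord0 i) -> forall i, c i = 0).

(* C is the unique matrix with bv == v * C modulo I.                          *)
Definition represents (I : set P) mu alpha (v : 'rV[P]_mu) (bv : 'rV[P]_alpha)
    (C : 'M[K]_(mu, alpha)) : Prop :=
  unique (fun D => congr_mod I bv (v *m mxconst D)) C.

End PseudoOrderIdeals.

(* Main.v *)
Require Import Defs.
From HB Require Import structures.
From mathcomp Require Import all_boot all_order all_algebra.
From mathcomp Require Import mpoly.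
From mathcomp Require Import boolp classical_sets functions cardinality.

Set Implicit Arguments.
Unset Strict Implicit.
Unset Printing Implicit Defensive.

Import Order.TTheory GRing.Theory.
Local Open Scope classical_set_scope.
Local Open Scope ring_scope.

(** A polynomial lies in phi(I) exactly when its image under psi = phi^-1 lies
in I, so every congruence modulo phi(I) becomes, after applying psi, a
congruence modulo I.  As psi is K-linear, psi(v C) = psi(v) C = v M C modulo I
for each matrix C over K ([congr_lc_inv_mul]): on coordinates with respect to
the basis v of P / I, passing from v to psi(v) is multiplication by M.
Everything then reduces to matrix algebra over K.

A linear relation v c = 0 modulo phi(I) is a relation M c = 0, so v is linearly
independent modulo phi(I) iff M has trivial kernel, that is, iff M is
invertible.  For M invertible, v also generates P modulo phi(I): psi(p) = v d
modulo I for some d, hence p = v (M^-1 d) modulo phi(I).  Similarly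
bv = v C modulo phi(I) means v N = v M C modulo I, that is N = M C, whose only
solution is C = M^-1 N. *)

Section Congruence.
Variables (K : fieldType) (n : nat) (I : set {mpoly K[n]}).
Hypothesis I_ideal : is_ideal I.
Local Notation P := {mpoly K[n]}.

Lemma congr_mod_sym m p (A B : 'M[P]_(m, p)) :
  congr_mod I A B -> congr_mod I B A.
Proof.
move=> AB i j; rewrite -opprB -mulN1r.
by apply: (idealM I_ideal); apply: AB.
Qed.

Lemma congr_mod_trans m p (B A C : 'M[P]_(m, p)) :
  congr_mod I A B -> congr_mod I B C -> congr_mod I A C.
Proof.
move=> AB BC i j; rewrite -(subrKA (B i j)).
by apply: (idealD I_ideal); [apply: AB | apply: BC].
Qed.

Lemma ideal_sum (T : finType) (F : T -> P) :
  (forall t, I (F t)) -> I (\sum_t F t).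
Proof.
move=> IF; apply: (big_ind I); [exact: ideal0 | | by []].
exact: (idealD I_ideal).
Qed.

Lemma congr_mod_mulr m p q (A B : 'M[P]_(m, p)) (C : 'M[P]_(p, q)) :
  congr_mod I A B -> congr_mod I (A *m C) (B *m C).
Proof.
move=> AB i j; rewrite !mxE -sumrB; apply: ideal_sum => k.
by rewrite -mulrBl mulrC; apply: (idealM I_ideal); apply: AB.
Qed.

End Congruence.

Section Coordinates.
Variables (K : fieldType) (n mu : nat).
Local Notation P := {mpoly K[n]}.
Implicit Types (I : set P) (v : 'rV[P]_mu).

Lemma mxconstM m p q (A : 'M[K]_(m, p)) (B : 'M[K]_(p, q)) :
  mxconst n (A *m B) = mxconst n A *m mxconst n B.
Proof. exact: map_mxM. Qed.

Lemma lincombE v p (C : 'M[K]_(mu, p)) i j :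
  (v *m mxconst n C) i j = \sum_k C k j *: v ord0 k.
Proof.
by rewrite mxE; apply: eq_bigr => k _; rewrite !mxE mulrC mul_mpolyC ord1.
Qed.

(** Coefficient families become column vectors, so that changes of coordinates
are matrix products. *)
Lemma basis_mod_colP I v :
  basis_mod I v <->
  (forall p : P, exists c : 'cV[K]_mu,
     congr_mod I (const_mx p : 'M_1) (v *m mxconst n c)) /\
  (forall c : 'cV[K]_mu, congr_mod I (v *m mxconst n c) 0 -> c = 0).
Proof.
split=> -[gen free]; split.
- move=> p; have [c Ic] := gen p; exists (\col_i c i) => i j.
  by rewrite lincombE mxE; under eq_bigr do rewrite mxE.
- move=> c Ic; apply/colP=> i; rewrite mxE.
  apply: (free (fun k => c k ord0)).
  by have := Ic ord0 ord0; rewrite lincombE mxE subr0.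
- move=> p; have [c /(_ ord0 ord0)] := gen p.
  by rewrite lincombE mxE => Ic; exists (fun k => c k ord0).
- move=> c Ic i; have /colP/(_ i) : \col_k c k = 0; last by rewrite !mxE.
  apply: free => j k; rewrite lincombE mxE subr0.
  by under eq_bigr do rewrite mxE.
Qed.

Lemma basis_mod_inj I v p (C D : 'M[K]_(mu, p)) :
  basis_mod I v ->
  congr_mod I (v *m mxconst n C) (v *m mxconst n D) -> C = D.
Proof.
case=> _ free CD; apply/matrixP=> i j; apply/eqP; rewrite -subr_eq0; apply/eqP.
apply: (free (fun k => C k j - D k j)).
under eq_bigr do rewrite scalerBl.
by rewrite sumrB -!(lincombE _ _ ord0); apply: CD.
Qed.

Lemma trivial_kernel_unitmx (M : 'M[K]_mu) :
  (forall c : 'cV[K]_mu, M *m c = 0 -> c = 0) -> M \in unitmx.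
Proof.
move=> kerM; rewrite -unitmx_tr -row_free_unit -kermx_eq0; apply/eqP.
apply: trmx_inj; rewrite trmx0; apply/matrixP=> i j.
have /colP/(_ i) : col j (kermx M^T)^T = 0; last by rewrite !mxE.
apply: kerM; rewrite colE mulmxA.
have -> : M *m (kermx M^T)^T = 0; last exact: mul0mx.
by apply: trmx_inj; rewrite trmx_mul trmxK mulmx_ker trmx0.
Qed.

End Coordinates.

Section Transport.
Variables (K : fieldType) (n : nat) (phi : linear_change K n).
Local Notation P := {mpoly K[n]}.
Local Notation psi := (lc_inv phi).

Lemma lc_invB (p q : P) : psi (p - q) = psi p - psi q.
Proof. by apply: (can_inj (lc_funK phi)); rewrite rmorphB /= !lc_invK. Qed.

Lemma lc_inv0 : psi 0 = 0.
Proof. by have := lc_invB 0 0; rewrite !subrr. Qed.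

Lemma lc_fun_const m p (C : 'M[K]_(m, p)) :
  map_mx phi (mxconst n C) = mxconst n C.
Proof.
by apply/matrixP=> i j; rewrite !mxE -[_%:MP]mulr1 mul_mpolyC linearZ rmorph1.
Qed.

(** The inverse psi is given as a bare function; it inherits K-linearity from the
algebra morphism phi, by injectivity of phi. *)
Lemma lc_inv_mul m p q (A : 'M[P]_(m, p)) (C : 'M[K]_(p, q)) :
  map_mx psi (A *m mxconst n C) = map_mx psi A *m mxconst n C.
Proof.
have psiK m' p' (B : 'M[P]_(m', p')) : map_mx phi (map_mx psi B) = B.
  by apply/matrixP=> i j; rewrite !mxE lc_invK.
have phiK m' p' (B : 'M[P]_(m', p')) : map_mx psi (map_mx phi B) = B.
  by apply/matrixP=> i j; rewrite !mxE lc_funK.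
by rewrite -[RHS]phiK map_mxM psiK lc_fun_const.
Qed.

Lemma image_lcE (I : set P) p : (phi @` I) p <-> I (psi p).
Proof.
split=> [[q Iq <-]|Ip]; first by rewrite lc_funK.
by exists (psi p) => //; rewrite lc_invK.
Qed.

Lemma congr_mod_image (I : set P) m p (A B : 'M[P]_(m, p)) :
  congr_mod (phi @` I) A B <-> congr_mod I (map_mx psi A) (map_mx psi B).
Proof.
by split=> AB i j; have := AB i j; rewrite image_lcE lc_invB !mxE.
Qed.

Section Matrix.
Variables (mu : nat) (I : set P) (v : 'rV[P]_mu) (M : 'M[K]_mu).
Hypotheses (I_ideal : is_ideal I) (v_basis : basis_mod I v).
Hypothesis M_eq : congr_mod I (map_mx psi v) (v *m mxconst n M).

Lemma congr_lc_inv_mul p (C : 'M[K]_(mu, p)) :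
  congr_mod I (map_mx psi (v *m mxconst n C)) (v *m mxconst n (M *m C)).
Proof. by rewrite lc_inv_mul mxconstM mulmxA; apply: congr_mod_mulr. Qed.

(** Coordinates modulo I are unique and psi(v C) has coordinates M C, so finding
coordinates modulo phi(I) is solving a linear system with matrix M. *)
Lemma congr_image_coordE p (A : 'rV[P]_p) (C D : 'M[K]_(mu, p)) :
  congr_mod I (map_mx psi A) (v *m mxconst n D) ->
  congr_mod (phi @` I) A (v *m mxconst n C) <-> M *m C = D.
Proof.
move=> AD; rewrite congr_mod_image; split=> [AC|MC].
  apply: (basis_mod_inj v_basis); apply: (congr_mod_trans I_ideal _ AD).
  apply: (congr_mod_sym I_ideal); apply: (congr_mod_trans I_ideal AC).
  exact: congr_lc_inv_mul.
apply: (congr_mod_trans I_ideal AD); rewrite -MC.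
by apply: (congr_mod_sym I_ideal); apply: congr_lc_inv_mul.
Qed.

Lemma congr_image_eq0 p (C : 'M[K]_(mu, p)) :
  congr_mod (phi @` I) (v *m mxconst n C) 0 <-> M *m C = 0.
Proof.
have psi0 : map_mx psi (0 : 'rV[P]_p) = 0.
  by apply/matrixP=> i j; rewrite !mxE lc_inv0.
have const0 : v *m mxconst n (0 : 'M_(mu, p)) = 0.
  by rewrite /mxconst map_mx0 mulmx0.
rewrite congr_mod_image psi0; split=> [vC|MC].
  apply: (basis_mod_inj v_basis); rewrite const0.
  apply: (congr_mod_trans I_ideal _ vC); apply: (congr_mod_sym I_ideal).
  exact: congr_lc_inv_mul.
by have := congr_lc_inv_mul C; rewrite MC const0.
Qed.

(** Invertibility follows from linear independence alone, since a square matrix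
with trivial kernel is invertible; generation is then automatic. *)
Lemma basis_mod_image_unitmx : basis_mod (phi @` I) v <-> M \in unitmx.
Proof.
rewrite basis_mod_colP; split=> [[_ free]|uM].
  by apply: trivial_kernel_unitmx => c /congr_image_eq0; apply: free.
split=> [p|c /congr_image_eq0 Mc]; last by rewrite -(mulKmx uM c) Mc mulmx0.
have [gen _] := (basis_mod_colP I v).1 v_basis.
have [d] := gen (psi p); rewrite -map_const_mx => pd; exists (invmx M *m d).
by apply/(congr_image_coordE _ pd); rewrite mulKVmx.
Qed.

Lemma represents_image alpha (bv : 'rV[P]_alpha) (N : 'M[K]_(mu, alpha)) :
  congr_mod I (map_mx psi bv) (v *m mxconst n N) ->
  M \in unitmx -> represents (phi @` I) v bv (invmx M *m N).
Proof.
move=> N_eq uM; split=> [|D].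
  by apply/(congr_image_coordE _ N_eq); rewrite mulKVmx.
by move/(congr_image_coordE _ N_eq) <-; rewrite mulKmx.
Qed.

End Matrix.
End Transport.

Theorem proposition2p11 (K : fieldType) (n mu alpha : nat)
    (calP bP : set {mpoly K[n]})
    (v : 'rV[{mpoly K[n]}]_mu) (bv : 'rV[{mpoly K[n]}]_alpha)
    (I : set {mpoly K[n]}) (phi : linear_change K n)
    (M : 'M[K]_mu) (N : 'M[K]_(mu, alpha))
    (calP_pseudo : pseudo_order_ideal calP bP)
    (v_calP : enumerates v calP) (bv_bP : enumerates bv bP)
    (I_ideal : is_ideal I) (v_basis : basis_mod I v)
    (M_eq : congr_mod I (map_mx (lc_inv phi) v) (v *m mxconst n M))
    (N_eq : congr_mod I (map_mx (lc_inv phi) bv) (v *m mxconst n N)) :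
  (basis_mod (phi @` I) v <-> M \in unitmx) /\
  (M \in unitmx ->
     represents (phi @` I) v bv (invmx M *m N)).
Proof.
split; first exact: basis_mod_image_unitmx.
exact: represents_image.
Qed.
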